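(* Let $d,n\ge 1$ be integers and let $\underline{l}=(l_0,l_1,\dots,l_{n-1})$ be a Kupisch series of type $\mathbf{A}_n$. Then the lattice $L_{\underline{l}}^d$ is (isomorphic to) a lattice quotient of $L_n^d$. In particular, $L_{\underline{l}}^d$ is a join-semidistributive lattice.
   Context: $os_n^{d}$ is the set of non-decreasing sequences $x=(x_1,\dots,x_d)$ of elements of $\{0,1,\dots,n-1\}$, ordered by the product (componentwise) order $\leq$. $L_n^d$ is the lattice, ordered by inclusion, of the $d$-torsion classes of the $(d-1)$-Auslander algebra of type $\mathbf{A}_n$. By a theorem of August et al., these are identified with the subsets $T\subseteq os_n^{d+1}$ satisfying the following two conditions, which we take as the definition of the elements of $L_n^d$: (1) for all $0\le i<n$, $\{x\in T\mid x_{d+1}=i\}$ is an order filter (up-closed subset) of the poset $\{x\in os_n^{d+1}\mid x_{d+1}=i\}$; (2) for all $x,z\in T$ such that $x_1\le z_1-1\le x_2\le z_2-1\le\cdots\le x_{d+1}\le z_{d+1}-1$, every $y\in os_n^{d+1}$ with $y_i\in\{x_i,z_i\}$ for each $i$ belongs to $T$. A Kupisch series of type $\mathbf{A}_n$ is a sequence $\underline{l}=(l_0,\dots,l_{n-1})$ of positive integers with $l_0=1$ and $2\le l_i\le l_{i-1}+1$ for all $1\le i\le n-1$. Put $os_{\underline{l}}^{d+1}=\{y\in os_n^{d+1}\mid y_1\ge y_{d+1}-l_{y_{d+1}}+1\}$. $L_{\underline{l}}^d$ is the lattice, ordered by inclusion, of the $d$-torsion classes of the $(d-1)$-Nakayama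 algebra of type $\mathbf{A}$ associated to $\underline{l}$. By a theorem of August et al., these are identified with the subsets $T\subseteq os_{\underline{l}}^{d+1}$ satisfying the following two conditions, which we take as the definition of the elements of $L_{\underline{l}}^d$: (1) for all $0\le i<n$, $\{x\in T\mid x_{d+1}=i\}$ is an order filter of the poset $\{x\in os_{\underline{l}}^{d+1}\mid x_{d+1}=i\}$ with the product order; (2) for all $x,z\in T$ such that $x_1\le z_1-1\le x_2\le z_2-1\le\cdots\le x_{d+1}\le z_{d+1}-1$, every $y\in os_{\underline{l}}^{d+1}$ with $y_i\in\{x_i,z_i\}$ for each $i$ belongs to $T$. A lattice congruence on $L$ is an equivalence relation compatible with $\wedge$ and $\vee$; the associated lattice quotient is the lattice on the equivalence classes, ordered by the order of $L$ on the minimum elements of the classes. A lattice is join-semidistributive if $x\vee y=x\vee z$ implies $x\vee(y\wedge z)=x\vee y$. *)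

(* Defs.v *)
From HB Require Import structures.
From mathcomp Require Import all_boot all_order.
Set Implicit Arguments. Unset Strict Implicit. Unset Printing Implicit Defensive.
Import Order.Theory.

(* The entries x_1, ..., x_m are indexed by 0, ..., m-1: when m = d+1, x_1 is
   [x ord0] and x_{d+1} is [x ord_max]. *)
Notation sequ n m := {ffun 'I_m -> 'I_n}.

Definition os (n m : nat) : {set sequ n m} :=
  [set x : sequ n m | [forall i : 'I_m, forall j : 'I_m, (i <= j)%N ==> (x i <= x j)%N]].

Definition seq_le n m (x y : sequ n m) : bool := [forall i, (x i <= y i)%N].

(* x_1 <= z_1 - 1 <= x_2 <= ... <= x_m <= z_m - 1, with integer subtraction:
   "x_i <= z_i - 1" reads x_i < z_i, and "z_i - 1 <= x_{i+1}" reads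
   z_i <= x_{i+1} + 1. *)
Definition interlaced n m (x z : sequ n m) : bool :=
  [forall i, (x i < z i)%N]
  && [forall i : 'I_m, forall j : 'I_m,
        (j == i.+1 :> nat) ==> (z i <= (x j).+1)%N].

Definition is_order_filter n m (P F : {set sequ n m}) : bool :=
  (F \subset P)
  && [forall x in F, forall y in P, seq_le x y ==> (y \in F)].

(* The two conditions are stated relatively to an ambient set O of sequences,
   which is [os n d.+1] for L_n^d and [os_kupisch d l] for L_l^d. *)
Definition is_dtors n d (O T : {set sequ n d.+1}) : bool :=
  [&& T \subset O,
      [forall i : 'I_n, is_order_filter [set x in O | x ord_max == i]
                                        [set x in T | x ord_max == i]]
    & [forall x in T, forall z in T, interlaced x z ==>
        [forall y in O, [forall i, y i \in [:: x i; z i]] ==> (y \in T)]]].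

Definition is_kupisch n (l : n.-tuple nat) : Prop :=
  [/\ forall i, (i < n)%N -> (0 < nth 0 l i)%N,
      nth 0 l 0 = 1%N
    & forall i, (0 < i)%N -> (i < n)%N ->
        (2 <= nth 0 l i)%N /\ (nth 0 l i <= (nth 0 l i.-1).+1)%N].

(* y_1 >= y_{d+1} - l_{y_{d+1}} + 1 in the integers, rearranged since the
   subtraction of nat is truncated. *)
Definition os_kupisch n d (l : n.-tuple nat) : {set sequ n d.+1} :=
  [set y in os n d.+1 |
     (y ord_max + 1 <= y ord0 + nth 0 l (y ord_max))%N].
Arguments os_kupisch {n} d l.

Record dtors n d (O : {set sequ n d.+1}) :=
  DTors { tset :> {set sequ n d.+1}; _ : is_dtors O tset }.

Section DTorsLattice.
Variables (n d : nat) (O : {set sequ n d.+1}).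

HB.instance Definition _ := [isSub for @tset n d O].
HB.instance Definition _ := [Finite of dtors O by <:].

Implicit Types S T U : dtors O.

Definition dtors_le S T : bool := tset S \subset tset T.

Fact dtors_disp : Order.disp_t. Proof. exact. Qed.

Fact dtors_le_refl : reflexive dtors_le.
Proof. by move=> S; apply: subxx. Qed.
Fact dtors_le_anti : antisymmetric dtors_le.
Proof. by move=> S T ST; apply/val_inj/eqP; rewrite eqEsubset. Qed.
Fact dtors_le_trans : transitive dtors_le.
Proof. by move=> S T U; apply: subset_trans. Qed.

HB.instance Definition _ := Order.Le_isPOrder.Build dtors_disp (dtors O)
  dtors_le_refl dtors_le_anti dtors_le_trans.

Lemma is_dtorsP (T : {set sequ n d.+1}) :
  reflect [/\ T \subset O,
    forall x y, x \in T -> y \in O -> y ord_max = x ord_max ->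
      seq_le x y -> y \in T
    & forall x z y, x \in T -> z \in T -> interlaced x z -> y \in O ->
        (forall i, y i \in [:: x i; z i]) -> y \in T] (is_dtors O T).
Proof.
apply: (iffP and3P) => -[sTO H1 H2]; split=> //.
- move=> x y xT yO exy lexy; have /forallP/(_ (x ord_max))/andP[_] := H1.
  move=> /forall_inP/(_ x); rewrite !inE xT eqxx => /(_ isT)/forall_inP/(_ y).
  by rewrite !inE yO exy eqxx lexy => /(_ isT)/andP[].
- move=> x z y xT zT xz yO Hy.
  move/forall_inP/(_ x xT)/forall_inP/(_ z zT): H2; rewrite xz.
  by move=> /forall_inP/(_ y yO)/implyP; apply; apply/forallP.
- apply/forallP=> i; apply/andP; split.
    apply/subsetP=> x; rewrite !inE => /andP[xT ->].
    by rewrite (subsetP sTO).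
  apply/forall_inP=> x; rewrite inE => /andP[xT /eqP exi].
  apply/forall_inP=> y; rewrite inE => /andP[yO /eqP eyi].
  apply/implyP=> lexy; rewrite inE eyi eqxx andbT.
  by apply: H1 lexy; rewrite // eyi exi.
- apply/forall_inP=> x xT; apply/forall_inP=> z zT; apply/implyP=> xz.
  apply/forall_inP=> y yO; apply/implyP=> /forallP; exact: H2 xz yO.
Qed.

(* The intersection of all T satisfying P (and O, if there is none). *)
Definition inter_set (P : pred (dtors O)) : {set sequ n d.+1} :=
  [set x in O | [forall T, P T ==> (x \in tset T)]].

Fact inter_set_dtors (P : pred (dtors O)) : is_dtors O (inter_set P).
Proof.
have in_inter x T : x \in inter_set P -> P T -> x \in tset T.
  by rewrite inE => /andP[_ /forallP/(_ T)/implyP].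
apply/is_dtorsP; split.
- by apply/subsetP=> x; rewrite inE => /andP[].
- move=> x y xI yO exy lexy; rewrite inE yO; apply/forallP=> T; apply/implyP.
  move=> PT; have /is_dtorsP[_ H _] := valP T.
  exact: H (in_inter _ _ xI PT) yO exy lexy.
- move=> x z y xI zI xz yO Hy; rewrite inE yO; apply/forallP=> T.
  apply/implyP=> PT; have /is_dtorsP[_ _ H] := valP T.
  exact: H (in_inter _ _ xI PT) (in_inter _ _ zI PT) xz yO Hy.
Qed.

Definition dtors_inter P : dtors O := DTors (inter_set_dtors P).

Lemma dtors_sub T : tset T \subset O.
Proof. by have /is_dtorsP[] := valP T. Qed.

Lemma dtors_interP (P : pred (dtors O)) U :
  reflect (forall T, P T -> dtors_le U T) (dtors_le U (dtors_inter P)).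
Proof.
apply: (iffP subsetP) => [sUI T PT | leU x xU].
  apply/subsetP=> x /sUI; rewrite inE => /andP[_ /forallP/(_ T)].
  by rewrite PT.
rewrite inE (subsetP (dtors_sub U)) //; apply/forallP=> T; apply/implyP=> PT.
exact: (subsetP (leU T PT)).
Qed.

Fact meet_dtors S T : is_dtors O (tset S :&: tset T).
Proof.
have /is_dtorsP[sO S1 S2] := valP S; have /is_dtorsP[_ T1 T2] := valP T.
apply/is_dtorsP; split.
- exact: subset_trans (subsetIl _ _) sO.
- move=> x y /setIP[xS xT] yO exy lexy; rewrite inE.
  by rewrite (S1 _ _ xS yO exy lexy) (T1 _ _ xT yO exy lexy).
- move=> x z y /setIP[xS xT] /setIP[zS zT] xz yO Hy; rewrite inE.
  by rewrite (S2 _ _ _ xS zS xz yO Hy) (T2 _ _ _ xT zT xz yO Hy).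
Qed.

Definition dtors_meet S T : dtors O := DTors (meet_dtors S T).
Definition dtors_join S T : dtors O :=
  dtors_inter [pred U | dtors_le S U && dtors_le T U].

Fact dtors_meetP U S T : (U <= dtors_meet S T)%O = (U <= S)%O && (U <= T)%O.
Proof. exact: subsetI. Qed.

Fact dtors_joinP S T U : (dtors_join S T <= U)%O = (S <= U)%O && (T <= U)%O.
Proof.
have lbJ V : (forall U, dtors_le S U && dtors_le T U -> dtors_le V U) ->
  dtors_le V (dtors_join S T) by move=> H; apply/dtors_interP.
apply/idP/andP => [leJU | [leSU leTU]].
  by split; apply: dtors_le_trans leJU; apply: lbJ => V /andP[].
by have /dtors_interP/(_ U) := dtors_le_refl (dtors_join S T); apply; apply/andP.
Qed.

HB.instance Definition _ := Order.POrder_MeetJoin_isLattice.Build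
  dtors_disp (dtors O) dtors_meetP dtors_joinP.

End DTorsLattice.

Notation L_A n d := (dtors (os n d.+1)).
Notation L_kupisch d l := (dtors (os_kupisch d l)).

Local Open Scope order_scope.

Record congruence disp (L : latticeType disp) := Congruence {
  cong_rel :> rel L;
  cong_equiv : equivalence_rel cong_rel;
  congI : forall x x' y y', cong_rel x x' -> cong_rel y y' ->
    cong_rel (x `&` y) (x' `&` y');
  congU : forall x x' y y', cong_rel x x' -> cong_rel y y' ->
    cong_rel (x `|` y) (x' `|` y')
}.

Record quot disp (L : finLatticeType disp) (r : congruence L) := Quot {
  qclass :> {set L};
  _ : qclass \in equivalence_partition r [set: L]
}.

Section QuotLattice.
Variables (disp : Order.disp_t) (L : finLatticeType disp) (r : congruence L).

HB.instance Definition _ := [isSub for @qclass _ L r].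
HB.instance Definition _ := [Finite of quot r by <:].

Implicit Types C D E : quot r.

Let rxx x : r x x. Proof. by case: (cong_equiv r x x x). Qed.
Let rL x y z : r x y -> r x z = r y z.
Proof. by case: (cong_equiv r x y z) => _; apply. Qed.
Let rC x y : r x y = r y x.
Proof.
by apply/idP/idP => rxy; [rewrite -(rL _ rxy) | rewrite -(rL _ rxy)].
Qed.

Fact class_proof x :
  [set y in [set: L] | r x y] \in equivalence_partition r [set: L].
Proof. by apply/imsetP; exists x; rewrite ?inE. Qed.

Definition class_of x : quot r := Quot (class_proof x).

Lemma mem_class_of x y : (y \in qclass (class_of x)) = r x y.
Proof. by rewrite !inE. Qed.

Lemma class_ofP C x : x \in qclass C -> C = class_of x.
Proof.
case: C => C HC /= xC; have /imsetP[z _ eC] := HC.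
have rzx : r z x by move: xC; rewrite eC !inE.
by apply/val_inj/setP => y; rewrite /= eC !inE /= (rL _ rzx).
Qed.

Fact qclass_has_min C : exists m, (m \in qclass C) && [forall x in qclass C, m <= x].
Proof.
have [x xC] : exists x, x \in qclass C.
  case: C => C /= /imsetP[x _ ->]; exists x; rewrite !inE /=; exact: rxx.
have [m mC minm] := @arg_minnP L x (mem (qclass C)) (fun m => #|[set y | y <= m]|) xC.
have {}mC : m \in qclass C by [].
exists m; rewrite mC; apply/forall_inP=> y yC.
have eC := class_ofP mC.
have mI : m `&` y \in qclass C.
  rewrite eC mem_class_of -[X in r X _]meetxx; apply: congI; rewrite ?rxx //.
  by rewrite -mem_class_of -eC.
have := minm _ mI; rewrite leEmeet; set A := [set _ | _]; set B := [set _ | _].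
move=> leAB; have sBA : B \subset A.
  by apply/subsetP=> z; rewrite !inE lexI => /andP[].
have /eqP eAB : B == A by rewrite eqEcard sBA.
have : m \in A by rewrite inE.
by rewrite -eAB inE lexI => /andP[_]; rewrite leEmeet.
Qed.

Definition qmin C : L := xchoose (qclass_has_min C).

Lemma qmin_in C : qmin C \in qclass C.
Proof. by case/andP: (xchooseP (qclass_has_min C)). Qed.

Lemma qmin_le C x : x \in qclass C -> qmin C <= x.
Proof. by case/andP: (xchooseP (qclass_has_min C)) => _ /forall_inP; apply. Qed.

Lemma qminK : cancel qmin class_of.
Proof. by move=> C; rewrite -(class_ofP (qmin_in C)). Qed.

Lemma qmin_class_le x : qmin (class_of x) <= x.
Proof. by apply: qmin_le; rewrite mem_class_of. Qed.

Lemma le_qmin_class C x : (qmin C <= qmin (class_of x)) = (qmin C <= x).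
Proof.
apply/idP/idP => [leC | lem]; first exact: le_trans leC (qmin_class_le x).
set q := qmin (class_of x); have rxq : r x q by rewrite -mem_class_of qmin_in.
have : qmin C `&` q \in qclass C.
  rewrite (class_ofP (qmin_in C)) mem_class_of qminK.
  by rewrite -[X in r X _](meet_idPl lem); apply: congI; rewrite ?rxx.
by move/qmin_le; rewrite lexI => /andP[].
Qed.

Definition quot_le C D : bool := qmin C <= qmin D.

Fact quot_disp : Order.disp_t. Proof. exact. Qed.

Fact quot_le_refl : reflexive quot_le.
Proof. by move=> C; apply: lexx. Qed.
Fact quot_le_anti : antisymmetric quot_le.
Proof. by move=> C D /le_anti/(can_inj qminK). Qed.
Fact quot_le_trans : transitive quot_le.
Proof. by move=> C D E; apply: le_trans. Qed.

HB.instance Definition _ := Order.Le_isPOrder.Build quot_disp (quot r)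
  quot_le_refl quot_le_anti quot_le_trans.

Definition quot_meet C D : quot r := class_of (qmin C `&` qmin D).
Definition quot_join C D : quot r := class_of (qmin C `|` qmin D).

Fact quot_meetP E C D : (E <= quot_meet C D) = (E <= C) && (E <= D).
Proof. by rewrite [LHS]le_qmin_class lexI. Qed.

Fact quot_joinP C D E : (quot_join C D <= E) = (C <= E) && (D <= E).
Proof.
suff e : qmin (quot_join C D) = qmin C `|` qmin D by rewrite [LHS]/(_ <= _) /= /quot_le e leUx.
apply: le_anti; rewrite qmin_class_le leUx !le_qmin_class.
by rewrite leUl leUr.
Qed.

HB.instance Definition _ := Order.POrder_MeetJoin_isLattice.Build
  quot_disp (quot r) quot_meetP quot_joinP.

End QuotLattice.

Definition lattice_isomorphic d1 (L1 : latticeType d1) d2 (L2 : latticeType d2) :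
    Prop :=
  exists f : {lmorphism L1 -> L2}, bijective f.

Definition is_lattice_quotient d1 (L1 : latticeType d1) d2
    (L2 : finLatticeType d2) : Prop :=
  exists r : congruence L2, lattice_isomorphic L1 (quot r).

Definition join_semidistributive disp (L : latticeType disp) : Prop :=
  forall x y z : L, x `|` y = x `|` z -> x `|` (y `&` z) = x `|` y.

(* Main.v *)
(** The map T |-> T :&: os_kupisch d l from L_n^d to L_l^d preserves meets.  It
    has a right adjoint V |-> {x | raise x \in V}, where raise x replaces each
    entry of x by its maximum with c = x_{d+1} - l_{x_{d+1}} + 1, so that raise x
    is the least element above x of the truncated poset with the same last
    coordinate; hence the map also preserves joins, and the adjoint is a section.
    Join-semidistributivity passes to images of finite lattices, so it remains to
    prove it for L_n^d.

    Suppose W = X \/ Y = X \/ Z and U = X \/ (Y /\ Z) <> W, and let b be the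
    least last coordinate of an element of W :\: U.  On sequences ending in b the
    two closure axioms of W become a relation "p produces q" with a single
    premise, the elements of W with smaller last coordinate being parameters
    that already belong to U.  Every element of W ending in b is reached
    from X or Y, and also from X or Z; so a strongly connected component that is
    minimal among those in W :\: U meets both Y and Z, in p and r say.  The
    maximum of p and r lies in Y /\ Z, hence in U, and it reaches the
    component, a contradiction. *)

Require Import Defs.
From HB Require Import structures.
From mathcomp Require Import all_boot all_order zify.
Set Implicit Arguments. Unset Strict Implicit. Unset Printing Implicit Defensive.
Import Order.Theory.

(** * Lattice quotients from surjective lattice morphisms *)

Section SurjectiveMorphism.
Local Open Scope order_scope.
Variables (d1 d2 : Order.disp_t) (L1 : latticeType d1) (L2 : finLatticeType d2).
Variables (f : L2 -> L1) (s : L1 -> L2).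
Hypotheses (fI : {morph f : x y / x `&` y}) (fU : {morph f : x y / x `|` y}).
Hypothesis sK : cancel s f.

Definition kernel_rel : rel L2 := fun x y => f x == f y.

Fact kernel_equiv : equivalence_rel kernel_rel.
Proof. by move=> x y z; split=> [|/eqP]; rewrite /kernel_rel // => ->. Qed.

Fact kernel_meet x x' y y' : kernel_rel x x' -> kernel_rel y y' ->
  kernel_rel (x `&` y) (x' `&` y').
Proof. by move=> /eqP ex /eqP ey; rewrite /kernel_rel !fI ex ey. Qed.

Fact kernel_join x x' y y' : kernel_rel x x' -> kernel_rel y y' ->
  kernel_rel (x `|` y) (x' `|` y').
Proof. by move=> /eqP ex /eqP ey; rewrite /kernel_rel !fU ex ey. Qed.

Definition kernel : congruence L2 :=
  Congruence kernel_equiv kernel_meet kernel_join.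

Lemma kernel_qmin x : f (qmin (class_of kernel x)) = f x.
Proof. by apply/esym/eqP; rewrite -[_ == _]/(kernel _ _) -mem_class_of qmin_in. Qed.

Lemma kernel_class_eq x y : f x = f y -> class_of kernel x = class_of kernel y.
Proof. by move=> e; apply/esym/class_ofP; rewrite mem_class_of; apply/eqP. Qed.

(** Only [sK] is known of [s]; composing it with the class map makes it a morphism, because elements
    with the same image under [f] have the same class. *)
Definition kernel_iso v : quot kernel := class_of kernel (s v).

Fact kernel_iso_meet : {morph kernel_iso : v w / v `&` w}.
Proof. by move=> v w; apply: kernel_class_eq; rewrite fI !kernel_qmin !sK. Qed.

Fact kernel_iso_join : {morph kernel_iso : v w / v `|` w}.
Proof. by move=> v w; apply: kernel_class_eq; rewrite fU !kernel_qmin !sK. Qed.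

Fact kernel_iso_omorph : {homo kernel_iso : v w / v <= w}.
Proof.
by move=> v w; rewrite !leEmeet => /eqP e; apply/eqP; rewrite -kernel_iso_meet e.
Qed.

HB.instance Definition _ :=
  Order.isOrderMorphism.Build d1 L1 (quot_disp d2) (quot kernel) kernel_iso
  kernel_iso_omorph.
HB.instance Definition _ :=
  Order.isLatticeMorphism.Build d1 L1 (quot_disp d2) (quot kernel) kernel_iso
  kernel_iso_meet kernel_iso_join.

Lemma kernel_iso_bij : bijective kernel_iso.
Proof.
exists (fun C => f (qmin C)) => [v | C]; first by rewrite kernel_qmin sK.
by rewrite -[RHS]qminK; apply: kernel_class_eq; rewrite sK.
Qed.

Lemma is_lattice_quotient_image : is_lattice_quotient L1 L2.
Proof. by exists kernel, kernel_iso; apply: kernel_iso_bij. Qed.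

(* Cutting lifts of x, y, z down to the minimum w of the fibre over x \/ y
   turns the equality x \/ y = x \/ z into an equality in L2. *)
Lemma join_semidistributive_image :
  join_semidistributive L2 -> join_semidistributive L1.
Proof.
move=> sd x y z exyz; pose w := qmin (class_of kernel (s (x `|` y))).
have fw : f w = x `|` y by rewrite kernel_qmin sK.
have fcut v : v <= x `|` y -> f (s v `&` w) = v.
  by move=> /meet_idPl lev; rewrite fI sK fw.
have xw : x <= x `|` y := leUl _ _.
(* The join on the left is below [w] and in the fibre of which [w] is the minimum. *)
have joinw v : v <= x `|` y -> x `|` v = x `|` y ->
    (s x `&` w) `|` (s v `&` w) = w.
  move=> vw ev; apply: le_anti; rewrite leUx !leIr /=.
  by apply: qmin_le; rewrite mem_class_of; apply/eqP; rewrite sK fU !fcut.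
have yw : y <= x `|` y := leUr _ _.
have zw : z <= x `|` y by rewrite exyz leUr.
have := sd (s x `&` w) (s y `&` w) (s z `&` w); rewrite !joinw //.
by move=> /(_ erefl)/(congr1 f); rewrite fU (fI (_ `&` w)) !fcut ?fw.
Qed.

End SurjectiveMorphism.

(* zify is very slow on boolean hypotheses that are not arithmetic. *)
Ltac nat_lia :=
  repeat match goal with H : is_true ?b |- _ =>
    lazymatch b with
    | leq _ _ => fail | andb _ _ => fail | negb _ => fail | _ => clear H
    end
  end; lia.

(** * Sequences and the closure axioms in terms of natural numbers *)

Section Entries.
Variables n d : nat.
Implicit Types (x y z : sequ n d.+1) (b : 'I_n).

(** Natural indices make [i.+1] available; [inord] reads every [i > d] as index 0. *)
Definition ent x (i : nat) : nat := x (inord i).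

Lemma ent_lt x i : ent x i < n. Proof. exact: ltn_ord. Qed.

Lemma ent_ord x (i : 'I_d.+1) : x i = ent x i :> nat.
Proof. by rewrite /ent inord_val. Qed.

Lemma ent_val x i : x (inord i) = ent x i :> nat. Proof. by []. Qed.

Lemma ent_max x : x ord_max = ent x d :> nat.
Proof. exact: ent_ord. Qed.

Lemma entP x y : (forall i, i <= d -> ent x i = ent y i) -> x = y.
Proof. by move=> e; apply/ffunP=> i; apply: val_inj; rewrite /= !ent_ord e // -ltnS. Qed.

Lemma osP x :
  reflect (forall i j, i <= j -> j <= d -> ent x i <= ent x j) (x \in os n d.+1).
Proof.
rewrite inE; apply: (iffP forallP) => [H i j ij jd | H i].
  have /forallP/(_ (inord j))/implyP := H (inord i); apply.
  by rewrite !inordK //; nat_lia.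
by apply/forallP=> j; apply/implyP=> ij; rewrite !ent_ord; apply: H; rewrite // -ltnS.
Qed.

Lemma seq_leP x y :
  reflect (forall i, i <= d -> ent x i <= ent y i) (seq_le x y).
Proof.
apply: (iffP forallP) => H i; first by move=> _; apply: H.
by rewrite !ent_ord H // -ltnS.
Qed.

Lemma interlacedP x z :
  reflect ((forall i, i <= d -> ent x i < ent z i) /\
           (forall i, i < d -> ent z i <= (ent x i.+1).+1)) (interlaced x z).
Proof.
apply: (iffP andP) => -[H1 H2]; split.
- by move=> i _; apply: (forallP H1).
- move=> i lid; have /forallP/(_ (inord i))/forallP/(_ (inord i.+1))/implyP := H2.
  by apply; rewrite !inordK //; nat_lia.
- by apply/forallP=> i; rewrite !ent_ord H1 // -ltnS.
- apply/forallP=> i; apply/forallP=> j; apply/implyP=> /eqP ej.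
  by rewrite !ent_ord ej H2 // -ltnS -ej.
Qed.

Lemma dtorsP (O T : {set sequ n d.+1}) :
  reflect [/\ T \subset O,
    forall x y, x \in T -> y \in O -> ent y d = ent x d ->
      (forall i, i < d -> ent x i <= ent y i) -> y \in T
    & forall x z y, x \in T -> z \in T ->
        (forall i, i <= d -> ent x i < ent z i) ->
        (forall i, i < d -> ent z i <= (ent x i.+1).+1) -> y \in O ->
        (forall i, i <= d -> ent y i = ent x i \/ ent y i = ent z i) -> y \in T]
    (is_dtors O T).
Proof.
apply: (iffP (is_dtorsP O T)) => -[sTO up ext]; split=> //.
- move=> x y xT yO e le_xy; apply: (up x) => //.
    by apply: ord_inj; rewrite !ent_max.
  apply/seq_leP=> i; rewrite leq_eqVlt => /orP[/eqP->|]; first by rewrite e.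
  exact: le_xy.
- move=> x z y xT zT lt_xz le_zx yO yxz; apply: (ext x z) => //.
    exact/interlacedP.
  move=> i; rewrite !inE -!val_eqE /= !ent_ord.
  by have [|->|->] := yxz i; rewrite ?eqxx ?orbT // -ltnS.
- move=> x y xT yO e /seq_leP le_xy; apply: (up x) => //; first by rewrite -!ent_max e.
  by move=> i /ltnW; apply: le_xy.
- move=> x z y xT zT /interlacedP[lt_xz le_zx] yO yxz; apply: (ext x z) => // i lid.
  by have := yxz (inord i); rewrite !inE => /orP[]/eqP; rewrite /ent => ->; auto.
Qed.

(* An entry f i >= n is replaced by b. *)
Definition seq_of b (f : nat -> nat) : sequ n d.+1 := [ffun i : 'I_d.+1 => insubd b (f i)].

Lemma ent_seq_of b f i : f i <= b -> i <= d -> ent (seq_of b f) i = f i.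
Proof.
move=> le_fb lid; rewrite /ent ffunE val_insubd inordK //.
by rewrite (leq_ltn_trans le_fb) /=.
Qed.

Lemma seq_of_os b f : (forall i, i <= d -> f i <= b) ->
  (forall i j, i <= j -> j <= d -> f i <= f j) -> seq_of b f \in os n d.+1.
Proof.
move=> fb fmono; apply/osP=> i j ij jd.
by rewrite !ent_seq_of ?fmono ?fb //; apply: leq_trans jd.
Qed.

Lemma dtors_leP (O : {set sequ n d.+1}) (S T : dtors O) :
  reflect {subset tset S <= tset T} (S <= T)%O.
Proof. exact: subsetP. Qed.

Lemma dtors_leW (O : {set sequ n d.+1}) (S T : dtors O) x :
  (S <= T)%O -> x \in tset S -> x \in tset T.
Proof. by move=> /dtors_leP; apply. Qed.

(* Axiom (2) in the special case where the last coordinate of y is that of z;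
   together with (1) it is all of (2).  The premise on p only says that p lies
   below the largest z interlaced with x. *)
Lemma dtors_step (T : L_A n d) x p q : x \in tset T -> p \in tset T ->
  ent x d < ent p d -> (forall i, i < d -> ent p i <= (ent x i.+1).+1) ->
  q \in os n d.+1 -> ent q d = ent p d ->
  (forall i, i < d -> ent x i <= ent q i) -> q \in tset T.
Proof.
have /dtorsP[sTO up ext] := valP T.
move=> xT pT lt_xp le_px qO eqp le_xq.
have /osP xmono := subsetP sTO x xT.
pose b := p (inord d); have eb : ent p d = b by [].
(* The largest sequence interlaced with [x] that ends like [p]; it lies above [p], so axiom (1) puts
   it in [T]. *)
pose fz i := if i == d then ent p d else (ent x i.+1).+1.
have fzb i : i <= d -> fz i <= b.
  move=> lid; rewrite /fz; case: eqP => // nid; rewrite -eb.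
  by have := xmono i.+1 d; nat_lia.
have ez i : i <= d -> ent (seq_of b fz) i = fz i by move=> lid; rewrite ent_seq_of ?fzb.
have zT : seq_of b fz \in tset T.
  apply: (up p) => //.
  - apply: seq_of_os => // i j ij jd; rewrite /fz.
    case: (eqVneq j d) => [jd'|jd']; first by have := fzb i; rewrite /fz -eb; nat_lia.
    by case: (eqVneq i d) => [?|?]; [nat_lia | have := xmono i.+1 j.+1; nat_lia].
  - by rewrite ez // /fz eqxx.
  - by move=> i lid; rewrite ez ?(ltnW lid) // /fz ltn_eqF // le_px.
(* Axiom (2) allows [x] with its last entry replaced by that of [p]; this sequence lies below
   [q]. *)
pose fy i := if i == d then ent p d else ent x i.
have fyb i : i <= d -> fy i <= b.
  by move=> lid; rewrite /fy; case: eqP => // nid; have := xmono i d; rewrite -eb; nat_lia.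
have ey i : i <= d -> ent (seq_of b fy) i = fy i by move=> lid; rewrite ent_seq_of ?fyb.
have yT : seq_of b fy \in tset T.
  apply: (ext x (seq_of b fz)) => //.
  - move=> i lid; rewrite ez // /fz; case: (eqVneq i d) => [->//|nid].
    by have := xmono i i.+1; nat_lia.
  - by move=> i lid; rewrite ez ?(ltnW lid) // /fz ltn_eqF.
  - apply: seq_of_os => // i j ij jd; rewrite /fy.
    case: (eqVneq j d) => [jd'|jd']; first by have := fyb i; rewrite /fy -eb; nat_lia.
    by case: (eqVneq i d) => [?|?]; [nat_lia | have := xmono i j; nat_lia].
  - by move=> i lid; rewrite ey // ez // /fy /fz; case: eqP; auto.
apply: (up _ _ yT) => //; first by rewrite ey // /fy eqxx.
by move=> i lid; rewrite ey ?(ltnW lid) // /fy ltn_eqF // le_xq.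
Qed.

End Entries.

(** * Restriction to the truncated poset and its right adjoint *)

Section Restriction.
Variables (n d : nat) (l : n.-tuple nat).
Hypothesis hl : is_kupisch l.
Implicit Types (x y z : sequ n d.+1).

(* Truncated subtraction: when b + 1 - l_b < 0, the bound y_1 >= 0 is void too. *)
Definition cut (b : nat) : nat := b.+1 - nth 0 l b.

Lemma cut_le b : b < n -> cut b <= b.
Proof. by have [h _ _] := hl; move=> /h; rewrite /cut; nat_lia. Qed.

(** The Kupisch condition [l_i <= l_{i-1} + 1] says exactly that [i + 1 - l_i] does not decrease. *)
Lemma cut_mono a b : a <= b -> b < n -> cut a <= cut b.
Proof.
have [_ _ h] := hl; elim: b => [|b IH]; first by rewrite leqn0 => /eqP->.
rewrite leq_eqVlt => /orP[/eqP->//|ab] bn.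
apply: leq_trans (IH _ _) _; [nat_lia|nat_lia|].
by have [] := h b.+1; rewrite // /cut /=; nat_lia.
Qed.

Lemma os_kupischP x :
  (x \in os_kupisch d l) = (x \in os n d.+1) && (cut (ent x d) <= ent x 0).
Proof.
rewrite inE /cut !ent_ord /=; congr (_ && _); apply/idP/idP; nat_lia.
Qed.

Lemma restrict_dtors (T : L_A n d) : is_dtors (os_kupisch d l) (tset T :&: os_kupisch d l).
Proof.
have /dtorsP[sTO up ext] := valP T.
have sub y : y \in os_kupisch d l -> y \in os n d.+1.
  by rewrite os_kupischP => /andP[].
apply/dtorsP; split; first exact: subsetIr.
- move=> x y /setIP[xT _] yO e le_xy; rewrite inE yO andbT.
  by apply: (up x) => //; apply: sub.
- move=> x z y /setIP[xT _] /setIP[zT _] lt_xz le_zx yO yxz; rewrite inE yO andbT.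
  by apply: (ext x z) => //; apply: sub.
Qed.

Definition restrict (T : L_A n d) : L_kupisch d l := DTors (restrict_dtors T).

Definition raise x : sequ n d.+1 :=
  seq_of d (x (inord d)) (fun i => maxn (ent x i) (cut (ent x d))).

Lemma ent_raise x i : x \in os n d.+1 -> i <= d ->
  ent (raise x) i = maxn (ent x i) (cut (ent x d)).
Proof.
move=> /osP xmono lid; rewrite ent_seq_of // ent_val.
by have := xmono i d lid; have := cut_le (ent_lt x d); nat_lia.
Qed.

Lemma ent_raise_last x : x \in os n d.+1 -> ent (raise x) d = ent x d.
Proof. by move=> xO; rewrite ent_raise //; have := cut_le (ent_lt x d); nat_lia. Qed.

Lemma raise_os x : x \in os n d.+1 -> raise x \in os_kupisch d l.
Proof.
move=> xO; rewrite os_kupischP ent_raise_last // ent_raise //; apply/andP; split; last by nat_lia.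
move: (xO) => /osP xmono.
by apply/osP=> i j ij jd; rewrite !ent_raise ?(leq_trans ij) //; have := xmono i j; nat_lia.
Qed.

Lemma raise_id x : x \in os_kupisch d l -> raise x = x.
Proof.
rewrite os_kupischP => /andP[xO c0]; apply: entP => i lid; rewrite ent_raise //.
by move/osP: xO => /(_ 0 i); nat_lia.
Qed.

Definition extend_set (V : L_kupisch d l) : {set sequ n d.+1} :=
  [set x in os n d.+1 | raise x \in tset V].

Lemma mem_extend V x :
  (x \in extend_set V) = (x \in os n d.+1) && (raise x \in tset V).
Proof. by rewrite [LHS]in_set. Qed.

(** Raising is monotone among sequences with the same last coordinate, which settles axiom (1). In
    axiom (2) the work is for a [y] ending like [z], since [x] and [z] are raised to different
    cuts. *)
Lemma extend_dtors V : is_dtors (os n d.+1) (extend_set V).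
Proof.
have /dtorsP[sVO up ext] := valP V.
apply/dtorsP; split; first by apply/subsetP=> x; rewrite mem_extend => /andP[].
- move=> x y; rewrite !mem_extend => /andP[xO xV] yO e le_xy; rewrite yO /=.
  apply: (up _ _ xV) => [||i lid]; rewrite ?raise_os ?ent_raise_last ?e //.
  by rewrite !ent_raise ?(ltnW lid) // e; have := le_xy i; nat_lia.
- move=> x z y; rewrite !mem_extend => /andP[xO xV] /andP[zO zV] lt_xz le_zx yO yxz.
  rewrite yO /=.
  have /osP xmono := xO; have /osP zmono := zO.
  have le_xy i : i <= d -> ent x i <= ent y i.
    by move=> lid; have := yxz i lid; have := lt_xz i lid; nat_lia.
  have upx : ent y d = ent x d -> raise y \in tset V.
    move=> e; apply: (up _ _ xV) => [||i lid]; rewrite ?raise_os ?ent_raise_last ?e //.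
    by rewrite !ent_raise ?(ltnW lid) // e; have := le_xy i; nat_lia.
  have [/upx//|e] := yxz d (leqnn d).
  have ltd := lt_xz d (leqnn d).
  set c := cut (ent z d).
  have cb : c <= ent z d := cut_le (ent_lt z d).
  (* If [x_d < c], then [z_i <= x_{i+1} + 1 <= c] for [i < d]: the raised [z] equals [c] before its
     last entry, so it lies below the raised [y]. *)
  have [lt_ac | le_ca] := ltnP (ent x d) c.
    apply: (up _ _ zV) => [||i lid]; rewrite ?raise_os ?ent_raise_last ?e //.
    rewrite !ent_raise ?(ltnW lid) // e -/c.
    by have := le_zx i lid; have := xmono i.+1 d; nat_lia.
  have ca : cut (ent x d) <= c by apply: cut_mono; rewrite ?ent_lt 1?ltnW.
  pose fx i := maxn (ent x i) c.
  have fxb i : i <= d -> fx i <= x (inord d).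
    by move=> lid; rewrite ent_val /fx; have := xmono i d; nat_lia.
  have ex i : i <= d -> ent (seq_of d (x (inord d)) fx) i = fx i.
    by move=> lid; rewrite ent_seq_of ?fxb.
  have x'V : seq_of d (x (inord d)) fx \in tset V.
    apply: (up _ _ xV) => [||i lid].
    - rewrite os_kupischP seq_of_os //= ?ex //; last first.
        by move=> i j ij jd; rewrite /fx; have := xmono i j; nat_lia.
      by rewrite /fx (maxn_idPl le_ca); nat_lia.
    - by rewrite ex // ent_raise_last // /fx (maxn_idPl le_ca).
    - by rewrite ex ?(ltnW lid) // ent_raise ?(ltnW lid) // /fx; nat_lia.
  (* Raising z to c + 1 rather than c keeps it strictly above x raised to c. *)
  pose fz i := maxn (ent z i) c.+1.
  have fzb i : i <= d -> fz i <= z (inord d).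
    by move=> lid; rewrite ent_val /fz; have := zmono i d; nat_lia.
  have ez i : i <= d -> ent (seq_of d (z (inord d)) fz) i = fz i.
    by move=> lid; rewrite ent_seq_of ?fzb.
  have z'V : seq_of d (z (inord d)) fz \in tset V.
    apply: (up _ _ zV) => [||i lid].
    - rewrite os_kupischP seq_of_os //= ?ez //; last first.
        by move=> i j ij jd; rewrite /fz; have := zmono i j; nat_lia.
      by rewrite /fz (maxn_idPl (leq_ltn_trans le_ca ltd)) -/c; nat_lia.
    - by rewrite ez // ent_raise_last // /fz (maxn_idPl (leq_ltn_trans le_ca ltd)).
    - by rewrite ez ?(ltnW lid) // ent_raise ?(ltnW lid) // -/c /fz; nat_lia.
  have dzb : ent z d = z (inord d) := erefl.
  (* The raised [x] with the last entry of [z]: axiom (2) produces it, and it lies below the raised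
     [y]. *)
  pose fw i := if i == d then ent z d else fx i.
  have fwb i : i <= d -> fw i <= z (inord d).
    by move=> lid; rewrite /fw -dzb; case: eqP => // nid; have := fxb i lid;
       rewrite ent_val; nat_lia.
  have ew i : i <= d -> ent (seq_of d (z (inord d)) fw) i = fw i.
    by move=> lid; rewrite ent_seq_of ?fwb.
  have wO : seq_of d (z (inord d)) fw \in os_kupisch d l.
    rewrite os_kupischP seq_of_os //= ?ew // /fw ?eqxx.
      by rewrite -/c; case: eqP; rewrite /fx; nat_lia.
    move=> i j ij jd; case: (eqVneq j d) => [jd'|jd'].
      by have := fwb i; rewrite /fw -dzb; nat_lia.
    by case: (eqVneq i d) => [?|?]; [nat_lia | have := xmono i j; rewrite /fx; nat_lia].
  have wV : seq_of d (z (inord d)) fw \in tset V.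
    apply: ext x'V z'V _ _ wO _ => i lid; rewrite ?ex ?ez ?ew ?(ltnW lid) //.
    - by rewrite /fx /fz; have := lt_xz i lid; nat_lia.
    - by rewrite /fx /fz; have := le_zx i lid; nat_lia.
    - rewrite /fw; case: eqP => [->|_]; last by left.
      by right; rewrite /fz; nat_lia.
  apply: (up _ _ wV) => [||i lid]; rewrite ?raise_os ?ent_raise_last ?e //.
    by rewrite ew // /fw eqxx.
  rewrite ent_raise ?(ltnW lid) // e ew ?(ltnW lid) // /fw ltn_eqF // /fx -/c.
  by have := le_xy i; nat_lia.
Qed.

Definition extend V : L_A n d := DTors (extend_dtors V).

Local Open Scope order_scope.

Lemma extendK : cancel extend restrict.
Proof.
move=> V; apply/val_inj/setP=> x; rewrite inE [x \in tset _]mem_extend.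
have [xK | xNK] := boolP (x \in os_kupisch d l).
  by rewrite raise_id // andbT; move: xK; rewrite os_kupischP => /andP[->].
by rewrite andbF; apply/esym/(contraNF _ xNK)/subsetP/dtors_sub.
Qed.

(** [raise x] lies above [x] with the same last coordinate, so it belongs to [S] when [x] does;
    conversely, [raise] fixes the truncated poset. *)
Lemma restrict_galois (S : L_A n d) (V : L_kupisch d l) :
  (restrict S <= V) = (S <= extend V).
Proof.
apply/dtors_leP/dtors_leP => [sSV x xS | sSV x].
  have /dtorsP[sSO up _] := valP S; have xO := subsetP sSO x xS.
  rewrite [_ \in _]mem_extend xO; apply: sSV.
  rewrite inE raise_os // andbT; apply: (up _ _ xS) => [||i lid].
  - by have := raise_os xO; rewrite os_kupischP => /andP[].
  - exact: ent_raise_last.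
  - by rewrite ent_raise ?leq_maxl // ltnW.
by case/setIP=> /sSV; rewrite mem_extend => /andP[_ +] xK; rewrite raise_id.
Qed.

Lemma restrict_meet : {morph restrict : S T / S `&` T}.
Proof. by move=> S T; apply/val_inj; rewrite /= -setIIl. Qed.

Lemma restrict_join : {morph restrict : S T / S `|` T}.
Proof.
have mono S T : S <= T -> restrict S <= restrict T.
  by rewrite !leEmeet -restrict_meet => /eqP->.
move=> S T; apply: le_anti.
rewrite restrict_galois leUx -!restrict_galois leUl leUr leUx /=.
by rewrite !mono ?leUl ?leUr.
Qed.

End Restriction.

(** * Induction inside a strongly connected component *)

Section StronglyConnected.
Variables (T : finType) (e : rel T).

Definition scc (r : T) : pred T := fun u => connect e u r && connect e r u.

(** A path from [u] to [v] never leaves the component, so [P] can be pulled back along it. *)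
Lemma scc_ind (P : T -> Prop) (r v : T) :
  (forall u u', scc r u -> scc r u' -> e u u' -> P u' -> P u) ->
  scc r v -> P v -> forall u, scc r u -> P u.
Proof.
move=> Pback Cv Pv u Cu.
have /connectP[s es ev] : connect e u v.
  by case/andP: Cu => ur _; case/andP: Cv => _; apply: connect_trans.
elim: s u Cu es ev => [|u' s IH] u Cu /=; first by move=> _ <-.
case/andP=> euu' es ev; have Cu' : scc r u'.
  case/andP: Cu => ur ru; apply/andP; split; last exact: connect_trans ru (connect1 euu').
  case/andP: Cv => vr _; apply: connect_trans vr.
  by apply/connectP; exists s.
by apply: (Pback u u') => //; apply: IH.
Qed.

End StronglyConnected.

(** * Join-semidistributivity of [L_A n d] *)

Section JoinSemidistributive.
Local Open Scope order_scope.
Variables n d : nat.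
Implicit Types (p q r x : sequ n d.+1).

Definition truncate a x : sequ n d.+1 := seq_of d a (fun i => minn (ent x i) a).

Definition seq_max p q : sequ n d.+1 :=
  [ffun i => if (p i <= q i)%N then q i else p i].

Lemma ent_seq_max p q i : ent (seq_max p q) i = maxn (ent p i) (ent q i).
Proof. by rewrite /ent ffunE; case: leqP => H; nat_lia. Qed.

Lemma seq_max_os p q :
  p \in os n d.+1 -> q \in os n d.+1 -> seq_max p q \in os n d.+1.
Proof.
move=> /osP pmono /osP qmono; apply/osP=> i j ij jd; rewrite !ent_seq_max.
by have := pmono i j ij jd; have := qmono i j ij jd; nat_lia.
Qed.

Section Slice.
Variables (W : L_A n d) (b : nat).

Definition slice p := (p \in os n d.+1) && (ent p d == b).

(* On sequences ending in b this is [dtors_step] from x and p to q. *)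
Definition passes x p q :=
  [&& x \in tset W, (ent x d < b)%N,
      [forall i : 'I_d, ent p i <= (ent x i.+1).+1]%N
    & [forall i : 'I_d, ent x i <= ent q i]%N].

Definition arrow : rel (sequ n d.+1) := fun p q =>
  [&& slice p, slice q & seq_le p q || [exists x, passes x p q]].

Lemma passesP x p q : reflect [/\ x \in tset W, (ent x d < b)%N,
     forall i, (i < d)%N -> (ent p i <= (ent x i.+1).+1)%N
   & forall i, (i < d)%N -> (ent x i <= ent q i)%N] (passes x p q).
Proof.
apply: (iffP and4P) => -[xW xb px xq]; split=> //.
- by move=> i lid; have /forallP/(_ (Ordinal lid)) := px.
- by move=> i lid; have /forallP/(_ (Ordinal lid)) := xq.
- by apply/forallP=> i; apply: px.
- by apply/forallP=> i; apply: xq.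
Qed.

(** The parameters of the arrows are elements of [W] ending below [b], so [T] has to contain [W]
    only there. This is used for a [T] smaller than [W]. *)
Lemma arrow_closed (T : L_A n d) p q :
  (forall x, (ent x d < b)%N -> x \in tset W -> x \in tset T) ->
  arrow p q -> p \in tset T -> q \in tset T.
Proof.
move=> WT /and3P[/andP[pO /eqP pb] /andP[qO /eqP qb] /orP[/seq_leP le_pq|/existsP pq]] pT.
  have /dtorsP[_ up _] := valP T; apply: (up p) => //; first by rewrite pb qb.
  by move=> i /ltnW; apply: le_pq.
case: pq => x /passesP[xW xb px xq].
by apply: (@dtors_step _ _ T x p q); rewrite ?pb ?qb //; apply: WT.
Qed.

Lemma connect_closed (T : L_A n d) p q :
  (forall x, (ent x d < b)%N -> x \in tset W -> x \in tset T) ->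
  connect arrow p q -> p \in tset T -> q \in tset T.
Proof.
move=> WT /connectP[s + ->]; elim: s p => //= r s IH p /andP[pr rs] pT.
by apply: IH rs _; apply: arrow_closed pr pT.
Qed.

End Slice.

(** The elements of [W] that are reachable from [X] or [Y] if they end in [b], and are unrestricted
    otherwise, form a torsion class [D] containing [X] and [Y], hence all of [W]. *)
Lemma join_generated (X Y : L_A n d) q : q \in tset (X `|` Y) ->
  exists2 p, p \in tset X :|: tset Y & connect (arrow (X `|` Y) (ent q d)) p q.
Proof.
set W := X `|` Y; set b := ent q d; move=> qW.
pose D := [set r in tset W | (ent r d == b) ==>
             [exists p in tset X :|: tset Y, connect (arrow W b) p r]].
have WO r : r \in tset W -> r \in os n d.+1 by apply/subsetP/dtors_sub.
have /dtorsP[_ upW extW] := valP W.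
have Dd : is_dtors (os n d.+1) D.
  have ext_arrow r t : r \in D -> (ent r d = b -> ent t d = b -> arrow W b r t) ->
      ent r d = ent t d -> t \in tset W -> t \in D.
    rewrite !inE => /andP[rW /implyP rX] rt e tW; rewrite tW; apply/implyP=> /eqP tb.
    have rb : ent r d = b by rewrite e.
    have /exists_inP[p pXY pr] := rX (introT eqP rb).
    apply/exists_inP; exists p => //; apply: connect_trans pr _.
    exact/connect1/rt.
  apply/dtorsP; split.
  - by apply/subsetP=> r; rewrite inE => /andP[/WO].
  - move=> r t rD tO e le_rt; have rW : r \in tset W by move: rD; rewrite inE => /andP[].
    apply: (ext_arrow r) => //; last exact: upW le_rt.
    move=> rb tb; apply/and3P; split; rewrite /slice ?tO ?(WO r) ?rb ?tb //=.
    apply/orP; left; apply/seq_leP=> i; rewrite leq_eqVlt => /orP[/eqP->|/le_rt//].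
    by rewrite e.
  - move=> r t y rD tD lt_rt le_tr yO yrt.
    have rW : r \in tset W by move: rD; rewrite inE => /andP[].
    have tW : t \in tset W by move: tD; rewrite inE => /andP[].
    have yW : y \in tset W by apply: extW lt_rt le_tr yO yrt.
    have le_ry i : (i <= d)%N -> (ent r i <= ent y i)%N.
      by move=> lid; have := yrt i lid; have := lt_rt i lid; nat_lia.
    (* If [y] ends like [r], it lies above [r]. If it ends like [t], the arrow goes from [t] to [y]
       with parameter [r]. *)
    have [e|e] := yrt d (leqnn d).
      apply: (ext_arrow r) => // rb yb.
      apply/and3P; split; rewrite /slice ?yO ?(WO r) ?rb ?yb //=.
      by apply/orP; left; apply/seq_leP.
    apply: (ext_arrow t) => // tb yb.
    apply/and3P; split; rewrite /slice ?yO ?(WO t) ?tb ?yb //=.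
    apply/orP; right; apply/existsP; exists r; apply/passesP; split=> //.
      by rewrite -tb lt_rt.
    by move=> i /ltnW; apply: le_ry.
have XYD r : r \in tset X :|: tset Y -> r \in D.
  move=> rXY; rewrite inE; apply/andP; split.
    by case/setUP: rXY; apply/subsetP; [apply: (@leUl _ _ X Y) | apply: (@leUr _ _ Y X)].
  by apply/implyP=> _; apply/exists_inP; exists r.
have leWD : W <= DTors Dd.
  by rewrite leUx; apply/andP; split; apply/dtors_leP=> r rT; apply: XYD;
     rewrite inE rT ?orbT.
have : q \in D by apply: (subsetP leWD).
by rewrite inE eqxx => /andP[_ /exists_inP].
Qed.

Section StronglyConnectedComponent.
Variables (W : L_A n d) (b : nat) (r : sequ n d.+1).
Local Notation A := (arrow W b).
Local Notation C := (scc A r).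

(* An application of some x' to u and v lifts to an application of
   seq_max v s truncated at the last coordinate of x, which lies above x. *)
Lemma arrow_lift x s u v :
  slice b s -> x \in tset W ->
  (forall i, (i < d)%N -> (ent x i <= ent s i <= (ent x d).+1)%N) ->
  (forall x', passes W b x' u v -> (ent x' d <= ent x d)%N) ->
  (ent x d < b)%N ->
  A u v -> A (seq_max u s) (seq_max v s).
Proof.
move=> /andP[sO /eqP sb] xW xs maxx xb /and3P[/andP[uO /eqP ub] /andP[vO /eqP vb] uv].
apply/and3P; split.
- by rewrite /slice seq_max_os // ent_seq_max ub sb maxnn eqxx.
- by rewrite /slice seq_max_os // ent_seq_max vb sb maxnn eqxx.
have [le_uv | nle_uv] := boolP (seq_le u v).
  apply/orP; left; apply/seq_leP=> i lid; rewrite !ent_seq_max.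
  by have /seq_leP/(_ i lid) := le_uv; nat_lia.
rewrite (negPf nle_uv) in uv; case/existsP: uv => x' px'.
have le_x'x := maxx x' px'.
have {px'} /passesP[x'W x'b ux' x'v] := px'.
apply/orP; right; apply/existsP.
pose y := truncate (x (inord d)) (seq_max v s).
have ey i : (i <= d)%N -> ent y i = minn (maxn (ent v i) (ent s i)) (ent x d).
  by move=> lid; rewrite ent_seq_of ?ent_seq_max // ent_val geq_minr.
have vsO := seq_max_os vO sO.
have yO : y \in os n d.+1.
  apply: seq_of_os => [i _ | i j ij jd]; first by rewrite geq_minr.
  by move/osP: vsO => /(_ i j ij jd); nat_lia.
have yd : ent y d = ent x d by rewrite ey // sb; nat_lia.
have /dtorsP[sWO up _] := valP W.
have /osP xmono := subsetP sWO x xW; have /osP x'mono := subsetP sWO x' x'W.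
have /osP smono := sO.
exists y; apply/passesP; split.
- apply: (up x) => // i lid; rewrite ey ?(ltnW lid) //.
  by have := xs i lid; have := xmono i d; nat_lia.
- by rewrite yd.
(* Both [u_i] and [s_i] are at most [x_d + 1], the former because [x'_{i+1} <= x'_d <= x_d], so
   truncation does no harm. When [i + 1 = d] the truncated entry is [x_d] itself. *)
- move=> i lid; rewrite ent_seq_max ey //.
  have := ux' i lid; have := x'mono i.+1 d; have := xs i lid.
  have := smono i i.+1; have := vb; have [id1|id1] := eqVneq i.+1 d.
    by rewrite id1 sb; nat_lia.
  by have := x'v i.+1; nat_lia.
- by move=> i lid; rewrite ent_seq_max ey ?(ltnW lid) //; nat_lia.
Qed.

(* The bounds needed by [arrow_lift] are provided by an application of
   [passes] inside the component whose x has the largest last coordinate. *)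
Lemma scc_max p : C p -> slice b r -> connect A (seq_max p r) r.
Proof.
move=> Cp rS; have Cr : C r by rewrite /scc connect0.
pose E := [pred t : sequ n d.+1 * sequ n d.+1 * sequ n d.+1 |
  [&& C t.1.2, C t.2, A t.1.2 t.2 & passes W b t.1.1 t.1.2 t.2]].
(* If no arrow inside the component uses [passes], all of them go upwards, so [p] lies below [r]. *)
have [t0 Et0 | E0] := pickP E; last first.
  suff /seq_leP le_pr : seq_le p r.
    rewrite (_ : seq_max p r = r) ?connect0 //; apply: entP => i lid.
    by rewrite ent_seq_max; apply/maxn_idPr/le_pr.
  apply: (@scc_ind _ A (fun u => seq_le u r) r r _ Cr _ p Cp); last by apply/seq_leP.
  move=> u u' Cu Cu' Auu' /seq_leP le_u'r.
  have /and3P[_ _ /orP[/seq_leP le_uu'|/existsP[x px]]] := Auu'.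
    by apply/seq_leP=> i lid; apply: leq_trans (le_uu' i lid) (le_u'r i lid).
  by have := E0 (x, u, u'); rewrite /= in Cu Cu' *; rewrite Cu Cu' Auu' px.
have [[[x u] v] /and4P[/= Cu Cv Auv pxuv] maxx] :=
  arg_maxnP (fun t : sequ n d.+1 * sequ n d.+1 * sequ n d.+1 => ent t.1.1 d) Et0.
have {}maxx x' w w' : C w -> C w' -> A w w' -> passes W b x' w w' ->
    (ent x' d <= ent x d)%N.
  by move=> Cw Cw' Aww' pw; apply: (maxx (x', w, w')); apply/and4P.
have /passesP[xW xb ux xv] := pxuv.
have /and3P[_ vS _] := Auv.
have osW t : t \in tset W -> t \in os n d.+1 by apply/subsetP/dtors_sub.
(* The bound holds at [u] and propagates backwards: an arrow either goes upwards or has a parameter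
   ending at most in [x_d]. *)
have bound (w : sequ n d.+1) : C w -> forall i, (i < d)%N -> (ent w i <= (ent x d).+1)%N.
  pose P (t : sequ n d.+1) := forall i, (i < d)%N -> (ent t i <= (ent x d).+1)%N.
  move=> Cw; rewrite -/(P w).
  apply: (@scc_ind _ A P r u _ Cu _ w Cw) => [w1 w2 Cw1 Cw2 A12 bw2|] i lid; last first.
    have /osP xmono := osW _ xW.
    by have := ux i lid; have := xmono i.+1 d; nat_lia.
  have /and3P[_ _ /orP[/seq_leP le12|/existsP[x' px']]] := A12.
    by have := le12 i (ltnW lid); have := bw2 i lid; nat_lia.
  have := maxx x' w1 w2 Cw1 Cw2 A12 px'.
  have /passesP[x'W _ w1x' _] := px'; have /osP x'mono := osW _ x'W.
  by have := w1x' i lid; have := x'mono i.+1 d; nat_lia.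
have lift s w w' : slice b s ->
    (forall i, (i < d)%N -> (ent x i <= ent s i <= (ent x d).+1)%N) ->
    C w -> C w' -> connect A (seq_max w s) (seq_max w' s).
  move=> sS xs Cw Cw'.
  pose P (t : sequ n d.+1) := connect A (seq_max t s) (seq_max w' s).
  apply: (@scc_ind _ A P r w' _ Cw' _ w Cw); last exact: connect0.
  move=> w1 w2 Cw1 Cw2 A12; apply: connect_trans; apply: connect1.
  by apply: (arrow_lift sS xW xs _ xb A12) => x'; apply: maxx A12.
have pS : slice b p.
  have /andP[/connectP[[|t s] /= es er] _] := Cp; first by rewrite -er.
  by case/andP: es => /and3P[].
have maxS w w' : slice b w -> slice b w' -> slice b (seq_max w w').
  move=> /andP[wO /eqP wb] /andP[w'O /eqP w'b].
  by rewrite /slice seq_max_os // ent_seq_max wb w'b maxnn eqxx.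
(* Thus [v] can serve as [s] in [lift], and then so can [seq_max r v]. *)
have bv i : (i < d)%N -> (ent x i <= ent v i <= (ent x d).+1)%N.
  by move=> lid; rewrite xv //= bound.
have rv_v : connect A (seq_max r v) v.
  have := lift v r v vS bv Cr Cv.
  by rewrite [X in connect _ _ X](_ : _ = v) //; apply: entP => i _; rewrite ent_seq_max maxnn.
pose s := seq_max r v.
have ps_s : connect A (seq_max p s) s.
  rewrite [X in connect _ _ X](_ : s = seq_max r s).
    apply: (lift _ _ _ _ _ Cp Cr); first exact: maxS.
    move=> i lid; rewrite ent_seq_max; have := bv i lid; have := bound r Cr i lid.
    by nat_lia.
  by apply: entP => i _; rewrite !ent_seq_max; nat_lia.
(* The path runs from [seq_max p r] up to [seq_max p s], then to [s], to [v] and to [r]. *)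
apply: (connect_trans (y := seq_max p s)).
  apply: connect1; rewrite /arrow !maxS //=.
  by apply/orP; left; apply/seq_leP=> i _; rewrite !ent_seq_max; nat_lia.
apply: connect_trans ps_s _; apply: connect_trans rv_v _.
by case/andP: Cv.
Qed.

End StronglyConnectedComponent.

Lemma join_semidistributive_L_A : join_semidistributive (L_A n d).
Proof.
move=> X Y Z eW; set W := X `|` Y; set U := X `|` (Y `&` Z).
have leUW : U <= W by rewrite leU2 ?leIl.
apply: le_anti; rewrite leUW /=; apply/dtors_leP.
suff H b q : ent q d = b -> q \in tset W -> q \in tset U by move=> q; apply: H.
elim/ltn_ind: b q => b IH q qb qW; apply/negPn/negP=> qNU.
have WU x : (ent x d < b)%N -> x \in tset W -> x \in tset U by move=> /IH; apply.
pose N := [pred p in tset W | (p \notin tset U) && (ent p d == b)].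
have qN : N q by rewrite /= qW qNU qb eqxx.
(* Minimizing the number of predecessors in [N] selects an element of a minimal component. *)
have [m /and3P[mW mNU /eqP mb] minm] :=
  @arg_minnP _ q N (fun p => #|[set r | N r && connect (arrow W b) r p]|) qN.
have gen Y' : W = X `|` Y' -> exists p, [/\ p \in tset Y', ent p d = b,
    connect (arrow W b) p m & connect (arrow W b) m p].
  move=> eY'; have := mW; rewrite eY' => /join_generated[p].
  rewrite -eY' mb => pXY pm.
  (* [U] is closed under arrows, so nothing in [U] reaches [m]; in particular [p] is not in [X]. *)
  have pNU : p \notin tset U by apply: contraNN mNU; apply: connect_closed WU pm.
  have pY : p \in tset Y'.
    case/setUP: pXY => // pX; case/negP: pNU; exact: dtors_leW (leUl _ _) pX.
  have pW : p \in tset W.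
    by rewrite eY'; exact: dtors_leW (leUr _ _) pY.
  have pb : ent p d = b.
    case/connectP: pm => -[|r s] /=; first by move=> _ <-.
    by case/andP=> /and3P[/andP[_ /eqP]].
  exists p; split=> //.
  have Np : N p by rewrite /= pW pNU pb eqxx.
  have Nm : N m by rewrite /= mW mNU mb eqxx.
  (* Predecessors of [p] are predecessors of [m], and minimality forces equality; as [m] precedes
     itself, it reaches [p]. *)
  have /setP/(_ m) : [set r | N r && connect (arrow W b) r p] =
                     [set r | N r && connect (arrow W b) r m].
    apply/eqP; rewrite eqEcard minm // andbT; apply/subsetP=> r.
    by rewrite !inE => /andP[-> /connect_trans->].
  by rewrite inE [in RHS]inE Nm connect0 /= => ->.
have [p [pY pb pm mp]] := gen Y erefl.
have [r [rZ rb rm mr]] := gen Z eW.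
have pO := subsetP (dtors_sub Y) p pY; have rO := subsetP (dtors_sub Z) r rZ.
have sO := seq_max_os pO rO.
have sYZ : seq_max p r \in tset (Y `&` Z).
  have /dtorsP[_ upY _] := valP Y; have /dtorsP[_ upZ _] := valP Z.
  have eb : ent (seq_max p r) d = b by rewrite ent_seq_max pb rb maxnn.
  rewrite [tset _](_ : _ = tset Y :&: tset Z) //; apply/setIP; split.
    by apply: (upY p) => // [|i _]; rewrite ?eb // ent_seq_max leq_maxl.
  by apply: (upZ r) => // [|i _]; rewrite ?eb // ent_seq_max leq_maxr.
have sU : seq_max p r \in tset U := dtors_leW (leUr _ _) sYZ.
case/negP: mNU; apply: connect_closed WU _ sU.
apply: connect_trans (rm); apply: scc_max; last by rewrite /slice rO rb eqxx.
by rewrite /scc (connect_trans pm mr) (connect_trans rm mp).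
Qed.

End JoinSemidistributive.

Theorem theorem4p28 (d n : nat) (l : n.-tuple nat)
  (hd : 1 <= d) (hn : 1 <= n) (hl : is_kupisch l) :
  is_lattice_quotient (L_kupisch d l) (L_A n d)
  /\ join_semidistributive (L_kupisch d l).
Proof.
have rI := @restrict_meet n d l.
have rU := restrict_join (d := d) hl.
have rK := extendK (d := d) hl.
split; first exact: is_lattice_quotient_image rI rU rK.
exact: join_semidistributive_image rI rU rK (@join_semidistributive_L_A n d).
Qed.
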